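(* Let $n\ge 2$, $F=GF(2^n)$, and let $\nu$ be the Frobenius automorphism of $F$, i.e. $\nu(x)=x^2$ for all $x\in F$. Let \[ A(n,\nu)=\left\{U(a,b)=\begin{bmatrix}1&0&0\\ a&1&0\\ b&\nu(a)&1\end{bmatrix} : a,b\in F\right\}, \] a group under matrix multiplication. Then \[ M_1(\mathcal{C}(A(n,\nu)))=2^n(2^n-1)^3,\qquad M_2(\mathcal{C}(A(n,\nu)))=2^{n-1}(2^n-1)^4, \] \[ M_1(\mathcal{NC}(A(n,\nu)))=2^{5n}(2^n-5)+2^{3n+2}(2^{n+1}-1), \] \[ M_2(\mathcal{NC}(A(n,\nu)))=2^{7n}(2^{n-1}-3)-2^{6n}(2^{n-1}-9)-2^{4n+1}(5\cdot 2^n-2). \] Further, for $\Gamma(A(n,\nu))=\mathcal{C}(A(n,\nu))$ and for $\Gamma(A(n,\nu))=\mathcal{NC}(A(n,\nu))$, \[ \frac{M_2(\Gamma(A(n,\nu)))}{|e(\Gamma(A(n,\nu)))|}=\frac{M_1(\Gamma(A(n,\nu)))}{|v(\Gamma(A(n,\nu)))|}. \]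
   Context: For a finite simple undirected graph $\Gamma$ with vertex set $v(\Gamma)$ and edge set $e(\Gamma)$, the first and second Zagreb indices are $M_1(\Gamma)=\sum_{v\in v(\Gamma)}\deg(v)^2$ and $M_2(\Gamma)=\sum_{uv\in e(\Gamma)}\deg(u)\deg(v)$. For a finite non-abelian group $G$ with center $Z(G)$, the commuting graph $\mathcal{C}(G)$ is the simple graph with vertex set $G\setminus Z(G)$ in which two distinct vertices $x,y$ are adjacent iff $xy=yx$; the non-commuting graph $\mathcal{NC}(G)$ is the complement of $\mathcal{C}(G)$ (same vertex set, distinct $x,y$ adjacent iff $xy\ne yx$). $GF(q)$ is the finite field with $q$ elements. *)

(* Defs.v *)
From HB Require Import structures.
From mathcomp Require Import all_boot all_order all_fingroup all_algebra.
From mathcomp Require Import all_solvable.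

Set Implicit Arguments.
Unset Strict Implicit.
Unset Printing Implicit Defensive.

Import GRing.Theory.

Record sgraph := SGraph {
  svertex :> finType;
  sadj : rel svertex;
  sadj_sym : symmetric sadj;
  sadj_irrefl : irreflexive sadj }.

Section Zagreb.
Variable Gamma : sgraph.

Definition deg (x : Gamma) : nat := #|[set y | sadj x y]|.

Definition edges : {set {set Gamma}} :=
  [set [set x; y] | x in [set: Gamma], y in [set: Gamma] & sadj x y].

Definition zagreb1 : nat := \sum_(x : Gamma) deg x ^ 2.

(* An edge e is the two-element set {u, v}, so the inner product is
   deg(u) * deg(v). *)
Definition zagreb2 : nat := \sum_(e in edges) \prod_(x in e) deg x.

Definition compl_adj : rel Gamma := fun x y => (x != y) && ~~ sadj x y.

Lemma compl_adj_sym : symmetric compl_adj.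
Proof. by move=> x y; rewrite /compl_adj eq_sym sadj_sym. Qed.

Lemma compl_adj_irrefl : irreflexive compl_adj.
Proof. by move=> x; rewrite /compl_adj eqxx. Qed.

Definition complement : sgraph := SGraph compl_adj_sym compl_adj_irrefl.

End Zagreb.

Section CommutingGraph.
Local Open Scope group_scope.
Variables (gT : finGroupType) (G : {group gT}).

Definition noncentral : finType := {x : gT | x \in G :\: 'Z(G)}.

Definition comm_adj : rel noncentral :=
  fun x y => (x != y) && (val x * val y == val y * val x).

Lemma comm_adj_sym : symmetric comm_adj.
Proof. by move=> x y; rewrite /comm_adj eq_sym [_ * _ == _]eq_sym. Qed.

Lemma comm_adj_irrefl : irreflexive comm_adj.
Proof. by move=> x; rewrite /comm_adj eqxx. Qed.

Definition commuting_graph : sgraph := SGraph comm_adj_sym comm_adj_irrefl.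

Definition noncommuting_graph : sgraph := complement commuting_graph.

End CommutingGraph.

Section Hanaki.
Local Open Scope ring_scope.
Variables (F : finFieldType) (nu : {rmorphism F -> F}).

(* The group is closed under products because nu is additive, so it exists for
   every ring endomorphism nu of F (an automorphism, as F is a finite field);
   the Frobenius nu x = x ^+ 2 requires characteristic 2. *)
Definition Umx (a b : F) : 'M[F]_3 :=
  \matrix_(i, j) nth 0 (nth [::] [:: [:: 1; 0;    0];
                                     [:: a; 1;    0];
                                     [:: b; nu a; 1]] i) j.

Definition Aset : {set {'GL_3[F]}} :=
  [set g : {'GL_3[F]} | [exists a, exists b, GLval g == Umx a b]].

Lemma Umx_mul a b c d : Umx a b *m Umx c d = Umx (a + c) (b + nu a * c + d).
Proof.
apply/matrixP=> i j; rewrite !mxE !big_ord_recl big_ord0 !mxE rmorphD /=.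
case: i => [[|[|[|//]]] ?]; case: j => [[|[|[|//]]] ?] /=;
  by rewrite ?(mul0r, mulr0, mul1r, mulr1, add0r, addr0, addrA).
Qed.

Lemma Umx0 : Umx 0 0 = 1%:M.
Proof.
apply/matrixP=> i j; rewrite !mxE rmorph0.
by case: i => [[|[|[|//]]] ?]; case: j => [[|[|[|//]]] ?].
Qed.

Lemma Aset_group_set : group_set Aset.
Proof.
apply/group_setP; split.
  by rewrite inE; apply/existsP; exists 0; apply/existsP; exists 0; rewrite Umx0.
move=> g h; rewrite !inE => /existsP[a /existsP[b /eqP ga]].
move=> /existsP[c /existsP[d /eqP hc]].
apply/existsP; exists (a + c); apply/existsP; exists (b + nu a * c + d).
by rewrite GL_ME ga hc -Umx_mul.
Qed.

Definition Agroup : {group {'GL_3[F]}} := Group Aset_group_set.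

End Hanaki.

(* Main.v *)
Require Import Defs.
From HB Require Import structures.
From mathcomp Require Import all_boot all_order all_fingroup all_algebra.
From mathcomp Require Import all_solvable ring zify.

(* Comparing entries, U(a,b) and U(c,d) commute iff a = 0, c = 0 or a = c;
   hence the center is {U(0,b)} and, with q = 2^n, the commuting graph is a
   disjoint union of q - 1 cliques of size q.  Both graphs are thus regular,
   of degrees q - 1 and q (q - 2), and for a d-regular graph M_1 = |v| d^2
   and M_2 = |e| d^2 with 2 |e| = |v| d. *)

Set Implicit Arguments.
Unset Strict Implicit.
Unset Printing Implicit Defensive.

Import GRing.Theory.
Local Open Scope ring_scope.

(** * Edge counting and Zagreb indices of regular graphs *)

Section RegularGraph.
Local Open Scope nat_scope.
Variable Gamma : sgraph.

Lemma edgesP (e : {set Gamma}) :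
  reflect (exists x y, sadj x y /\ e = [set x; y]) (e \in edges Gamma).
Proof.
apply: (iffP imset2P) => [[x y _]|[x [y [xy ->]]]].
  by rewrite inE => /andP[_ xy] ->; exists x, y.
by exists x y; rewrite // inE xy andbT.
Qed.

Lemma card_edge (e : {set Gamma}) : e \in edges Gamma -> #|e| = 2.
Proof.
case/edgesP=> x [y [xy ->]]; rewrite cards2.
by case: eqP xy => // ->; rewrite sadj_irrefl.
Qed.

Lemma incident_edges (x : Gamma) :
  [set e in edges Gamma | x \in e]
    = (fun y => [set x; y]) @: [set y | sadj x y].
Proof.
apply/setP=> e; rewrite inE; apply/andP/imsetP => [[/edgesP[u [v [uv ->]]]]|].
  rewrite !inE => /orP[]/eqP xE; subst x; first by exists v; rewrite ?inE.
  by exists u; rewrite ?inE 1?sadj_sym // setUC.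
case=> y; rewrite inE => xy ->; rewrite !inE eqxx; split=> //.
by apply/edgesP; exists x, y.
Qed.

(** The map sending y to {x, y} is injective on the neighbours of x: if {x, y} = {x, z}, then y is x
    or z, and y = x would be a loop. *)
Lemma card_incident_edges (x : Gamma) :
  #|[set e in edges Gamma | x \in e]| = deg x.
Proof.
rewrite incident_edges card_in_imset // => y z; rewrite !inE => xy xz /setP/(_ y).
rewrite !inE eqxx orbT => /esym/orP[]/eqP // yx.
by move: xy; rewrite yx sadj_irrefl.
Qed.

(** Double counting of the pairs (e, x) with x in e: each edge has two ends, each vertex lies on
    [deg x] edges. *)
Lemma handshake : #|edges Gamma| * 2 = \sum_(x : Gamma) deg x.
Proof.
transitivity (\sum_(e in edges Gamma) \sum_(x in e) 1).
  by rewrite -sum_nat_const; apply: eq_bigr => e eE; rewrite sum1_card card_edge.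
rewrite (exchange_big_dep predT) //=; apply: eq_bigr => x _.
by rewrite sum1dep_card card_incident_edges.
Qed.

Variable d : nat.
Hypothesis regular : forall x : Gamma, deg x = d.

Lemma regular_edges : #|edges Gamma| * 2 = #|Gamma| * d.
Proof. by rewrite handshake -sum_nat_const; apply: eq_bigr. Qed.

Lemma regular_zagreb1 : zagreb1 Gamma = #|Gamma| * d ^ 2.
Proof. by rewrite -sum_nat_const; apply: eq_bigr => x _; rewrite regular. Qed.

Lemma regular_zagreb2 : zagreb2 Gamma = #|edges Gamma| * d ^ 2.
Proof.
rewrite -sum_nat_const; apply: eq_bigr => e eE.
by rewrite (eq_bigr (fun=> d)) // prod_nat_const card_edge.
Qed.

(** Doubling replaces the edge count by |v| d, with no division by 2. *)
Lemma regular_zagreb2_double : zagreb2 Gamma * 2 = #|Gamma| * d ^ 3.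
Proof. by rewrite regular_zagreb2 mulnAC regular_edges -mulnA -expnS. Qed.

(** Both quotients equal [d ^ 2]; positivity makes both denominators nonzero. *)
Lemma regular_zagreb_ratio : 0 < #|Gamma| -> 0 < d ->
  ((zagreb2 Gamma)%:R / #|edges Gamma|%:R
    = (zagreb1 Gamma)%:R / #|Gamma|%:R :> rat)%R.
Proof.
move=> V_gt0 d_gt0; have E_gt0 : 0 < #|edges Gamma|.
  by have := regular_edges; nia.
rewrite regular_zagreb1 regular_zagreb2 !natrM mulrAC divff ?mul1r; last first.
  by rewrite Num.Theory.pnatr_eq0 -lt0n.
by rewrite mulrAC divff ?mul1r // Num.Theory.pnatr_eq0 -lt0n.
Qed.

Lemma regular_complement (x : complement Gamma) :
  deg x = #|Gamma| - d.+1.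
Proof.
(* The non-neighbours exclude x itself, whence [d.+1]. *)
rewrite /deg [LHS](_ : _ = #|~: (x |: [set y : Gamma | sadj (x : Gamma) y])|).
  rewrite cardsCs setCK cardsU1 inE sadj_irrefl /= add1n.
  by rewrite -(regular (x : Gamma)).
apply: eq_card => y; rewrite !inE /sadj /= /compl_adj negb_or.
by rewrite eq_sym.
Qed.

End RegularGraph.

(** * Commutation, center and degrees in A(n, nu) *)

Section HanakiGroup.
Variables (F : finFieldType) (nu : {rmorphism F -> F}).

Lemma Umx_inj a b c d : Umx nu a b = Umx nu c d -> a = c /\ b = d.
Proof.
move=> /matrixP U; split.
  by have := U (inord 1) (inord 0); rewrite !mxE !inordK.
by have := U (inord 2) (inord 0); rewrite !mxE !inordK.
Qed.

Lemma Umx_unit a b : Umx nu a b \in unitmx.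
Proof.
(* The inverse comes from solving a + c = 0 and b + nu(a) c + d = 0 for c and d. *)
have: Umx nu a b *m Umx nu (- a) (nu a * a - b) = 1%:M.
  by rewrite Umx_mul -(Umx0 nu); congr Umx; ring.
by case/mulmx1_unit.
Qed.

Definition Uelt a b : {'GL_3[F]} := Sub (Umx nu a b) (Umx_unit a b).

Lemma Uelt_inj a b c d : Uelt a b = Uelt c d -> a = c /\ b = d.
Proof. by move/(congr1 val)/Umx_inj. Qed.

Lemma AgroupP g : reflect (exists a b, g = Uelt a b) (g \in Agroup nu).
Proof.
rewrite inE; apply: (iffP existsP) => [[a /existsP[b /eqP gE]]|[a [b ->]]].
  by exists a, b; apply: val_inj.
by exists a; apply/existsP; exists b.
Qed.

Hypothesis nuE : forall x : F, nu x = x ^+ 2.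
Hypothesis F_gt2 : (2 < #|F|)%N.

(** The two products can differ only in the bottom-left entry, where the difference a^2 c - c^2 a =
    a c (a - c) vanishes iff a factor does. *)
Lemma Uelt_comm a b c d :
  (Uelt a b * Uelt c d == Uelt c d * Uelt a b)%g = [|| a == 0, c == 0 | a == c].
Proof.
rewrite -val_eqE /= -!mulmxE !Umx_mul !nuE.
rewrite -[in RHS](subr_eq0 a c) -!mulf_eq0.
have eq_diff : (b + a ^+ 2 * c + d) - (d + c ^+ 2 * a + b) = a * (c * (a - c)).
  by ring.
apply/eqP/eqP => [/Umx_inj[_ E]|E]; first by rewrite -eq_diff E subrr.
by rewrite [a + c]addrC; congr Umx; apply/subr0_eq; rewrite eq_diff.
Qed.

Lemma Uelt_noncentral a b : (Uelt a b \in Agroup nu :\: 'Z(Agroup nu)%g) = (a != 0).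
Proof.
have UG c d : Uelt c d \in Agroup nu by apply/AgroupP; exists c, d.
rewrite in_setD UG andbT; congr negb; apply/idP/eqP => [/centerP[_ aZ]|->].
  (* As |F| > 2, some c avoids 0 and a; commuting with U(c,0) then forces a = 0. *)
  have [c] : exists c, c \in ~: [set a; 0].
    apply/card_gt0P; rewrite cardsCs setCK cards2 subn_gt0.
    by apply: leq_ltn_trans F_gt2; case: (a != 0).
  rewrite !inE negb_or => /andP[ca c0].
  have /eqP := aZ _ (UG c 0); rewrite Uelt_comm (negPf c0) [a == c]eq_sym (negPf ca).
  by rewrite !orbF => /eqP.
apply/centerP; split=> // _ /AgroupP[c [d ->]].
by apply/eqP; rewrite Uelt_comm eqxx.
Qed.

Lemma noncentralE (x : noncentral (Agroup nu)) :
  exists a b, a != 0 /\ val x = Uelt a b.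
Proof.
have xG := valP x; have /AgroupP[a [b xE]] : val x \in Agroup nu.
  by move: xG; rewrite inE => /andP[].
by exists a, b; rewrite -(Uelt_noncentral a b) -xE.
Qed.

Lemma card_noncentral : #|noncentral (Agroup nu)| = (#|F|.-1 * #|F|)%N.
Proof.
rewrite card_sig.
rewrite (_ : #|_| = #|(fun p => Uelt p.1 p.2) @: setX [set~ 0] [set: F]|).
  rewrite card_imset; last by move=> [a b] [c d] /= /Uelt_inj[-> ->].
  by rewrite cardsX cardsC1 cardsT.
apply: eq_card => g; apply/idP/imsetP => [gG|[[a b]]].
  have [a [b [a0 gE]]] := noncentralE (exist _ g gG).
  by exists (a, b); rewrite // !inE andbT.
by case/setXP; rewrite in_setC1 /= -(Uelt_noncentral a b) => abG _ ->.
Qed.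

(* The neighbours of U(a,b) are the U(a,c) with c <> b. *)
Lemma commuting_deg (x : commuting_graph (Agroup nu)) : deg x = #|F|.-1.
Proof.
have [a [b [a0 xE]]] := noncentralE x.
rewrite /deg -(card_imset _ val_inj).
rewrite (_ : _ @: _ = (Uelt a @: [set: F]) :\ Uelt a b).
  have := cardsD1 (Uelt a b) (Uelt a @: [set: F]).
  rewrite imset_f // card_imset ?cardsT; first by move->.
  by move=> c d /Uelt_inj[].
apply/setP=> g; rewrite in_setD1; apply/imsetP/andP.
  case=> y; rewrite inE /sadj /= /comm_adj => /andP[xy xyC] ->.
  have [c [d [c0 yE]]] := noncentralE y.
  rewrite -xE val_eqE eq_sym xy; split=> //.
  move: xyC; rewrite xE yE Uelt_comm (negPf a0) (negPf c0) /= => /eqP->.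
  by rewrite -[sval y]/(val y) yE imset_f.
case=> gx /imsetP[d _ gE]; have gG : g \in Agroup nu :\: 'Z(Agroup nu)%g.
  by rewrite gE Uelt_noncentral.
exists (exist _ g gG) => //; rewrite inE /sadj /= /comm_adj -val_eqE /= xE.
by rewrite eq_sym gx gE Uelt_comm eqxx !orbT.
Qed.

End HanakiGroup.

(** * Evaluation of the indices as polynomials in q *)

Theorem theorem2p15 (n : nat) (F : finFieldType) (nu : {rmorphism F -> F})
    (n_ge2 : (2 <= n)%N) (cardF : #|F| = (2 ^ n)%N)
    (nuE : forall x : F, nu x = x ^+ 2) :
  let C := commuting_graph (Agroup nu) in
  let NC := noncommuting_graph (Agroup nu) in
  let ratio_eq (Gamma : sgraph) :=
    (zagreb2 Gamma)%:R / #|edges Gamma|%:R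
      = (zagreb1 Gamma)%:R / #|Gamma|%:R :> rat in
  [/\ (zagreb1 C)%:Z = 2 ^+ n * (2 ^+ n - 1) ^+ 3,
      (zagreb2 C)%:Z = 2 ^+ n.-1 * (2 ^+ n - 1) ^+ 4,
      (zagreb1 NC)%:Z
        = 2 ^+ (5 * n) * (2 ^+ n - 5) + 2 ^+ (3 * n + 2) * (2 ^+ n.+1 - 1),
      (zagreb2 NC)%:Z
        = 2 ^+ (7 * n) * (2 ^+ n.-1 - 3) - 2 ^+ (6 * n) * (2 ^+ n.-1 - 9)
          - 2 ^+ (4 * n + 1) * (5 * 2 ^+ n - 2)
    & ratio_eq C /\ ratio_eq NC].
Proof.
move=> C NC ratio_eq.
have [m nE] : exists m, n = m.+1 by exists n.-1; lia.
(* Here h = q / 2 = 2^(n-1), so both 2^n and 2^(n-1) are polynomials in h. *)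
pose h := (2 ^ m)%N.
have h_ge2 : (2 <= h)%N by rewrite /h -[X in (X <= _)%N]/(2 ^ 1)%N leq_exp2l //; lia.
have qE : #|F| = h.*2 by rewrite cardF nE expnS mul2n.
have F_gt2 : (2 < #|F|)%N by lia.
have cardV : #|C| = (#|F|.-1 * #|F|)%N := card_noncentral nuE F_gt2.
have degC : forall x : C, deg x = #|F|.-1 := commuting_deg nuE F_gt2.
have degNC (x : NC) : deg x = (#|C| - #|F|.-1.+1)%N := regular_complement degC x.
have V_gt0 : (0 < #|C|)%N by rewrite cardV; nia.
have dC_gt0 : (0 < #|F|.-1)%N by lia.
have dNC_gt0 : (0 < #|C| - #|F|.-1.+1)%N by rewrite cardV; nia.
have Z1C := regular_zagreb1 degC; have Z1NC := regular_zagreb1 degNC.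
have Z2C := regular_zagreb2_double degC.
have Z2NC := regular_zagreb2_double degNC.
(* Writing h = k + 2 removes truncated subtraction: q - 1 = 2k + 3 and q - 2 = 2k + 2. *)
have [k hE] : exists k, h = k.+2 by exists h.-2; lia.
have q1E : (k.+2.*2.-1 = 2 * k + 3)%N by lia.
have q2E : (k.+2.*2 = 2 * k + 4)%N by lia.
(* The non-commuting degree: q (q - 1) - q = q (q - 2). *)
have dE : ((2 * k + 3) * (2 * k + 4) - (2 * k + 3).+1
           = (2 * k + 4) * (2 * k + 2))%N.
  by rewrite -[RHS](addnK (2 * k + 3).+1); congr (_ - _)%N; lia.
(* A graph and its complement share their vertex type, so this holds by conversion. *)
rewrite -[#|NC|]/#|C| in Z1NC Z2NC.
rewrite !cardV qE hE q1E q2E ?dE in Z1C Z1NC Z2C Z2NC.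
have p_n : 2 ^+ n = (2 * h)%:Z.
  by rewrite nE exprS /h PoszM -[Posz (2 ^ m)]natz natrX.
have p_m : 2 ^+ n.-1 = h%:Z by rewrite nE /h -[Posz (2 ^ m)]natz natrX.
have p_mul j : 2 ^+ (j * n) = (2 ^+ n) ^+ j :> int by rewrite mulnC exprM.
(* M_2 is known only through its double, so its identities are proved after multiplication by 2. *)
have two_inj : injective (fun z : int => z * 2) by apply: mulIf.
(* Every power of 2 with n in its exponent becomes a polynomial in k, within reach of [ring]. *)
rewrite [2 ^+ n.+1]exprS ![2 ^+ (_ * n + _)]exprD !p_mul p_n p_m hE.
split.
- by rewrite Z1C; ring.
- by apply: two_inj; rewrite /= -PoszM Z2C; ring.
- by rewrite Z1NC; ring.
- by apply: two_inj; rewrite /= -PoszM Z2NC; ring.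
split; first exact: regular_zagreb_ratio degC _ _.
exact: regular_zagreb_ratio degNC _ _.
Qed.
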